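(* Consider a finite MDP $\langle\mathcal S,\mathcal A,(\mathcal A(s),s\in\mathcal S),P,r\rangle$ such that the Markov chain under every randomized stationary policy is ergodic (irreducible and aperiodic), and let $\alpha\in(0,1]$. Given a policy $u\in\mathcal U^{\rm DS}$, let $\lambda=\mathrm{VaR}^u$. If there exists another policy $u'\in\mathcal U^{\rm DS}$ such that $F^{u'}(\lambda)<\alpha$, then $\mathrm{VaR}^{u'}>\mathrm{VaR}^u$.
   Context: MDP: $\mathcal S$ and $\mathcal A$ are finite sets; $\mathcal A(s)\subseteq\mathcal A$ is the nonempty set of admissible actions in $s$, with $\cup_s\mathcal A(s)=\mathcal A$; $\mathcal K:=\{(s,a):s\in\mathcal S,a\in\mathcal A(s)\}$; $P(\cdot|s,a)$ is a probability distribution on $\mathcal S$ for each $(s,a)\in\mathcal K$; $r:\mathcal K\to\mathbb R$ is the reward function. Policies: $\mathcal U^{\rm RS}$ is the set of randomized stationary policies, i.e. maps $s\mapsto u(\cdot|s)$ with $u(\cdot|s)$ a probability distribution on $\mathcal A(s)$; $\mathcal U^{\rm DS}$ is the subset of deterministic ones (maps $u:\mathcal S\to\mathcal A$ with $u(s)\in\mathcal A(s)$). Under $u$, the state process is a Markov chain on $\mathcal S$ with transition matrix $\sum_{a}u(a|s)P(s'|s,a)$, and $\pi^u(s,a):=\lim_{t\to\infty}\mathbb P^u_{s_0}(s_t=s,a_t=a)$, which by ergodicity exists and does not depend on $s_0$. Steady-state quantities: $R^u_\infty$ is the random variable $r(s,a)$ with $(s,a)\sim\pi^u$; for $\lambda\in\mathbb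 R$, $F^u(\lambda):=\mathbb P(R^u_\infty\le\lambda)$; $\mathrm{VaR}^u:=\inf\{\lambda\in\mathbb R:F^u(\lambda)\ge\alpha\}$. *)

(* Defs.v *)
From HB Require Import structures.
From mathcomp Require Import all_boot all_order all_algebra.
From mathcomp Require Import boolp classical_sets reals.
From mathcomp Require Import topology normedtype sequences.
Set Implicit Arguments.
Unset Strict Implicit.
Unset Printing Implicit Defensive.
Import Order.TTheory GRing.Theory Num.Theory.
Import numFieldNormedType.Exports.
Local Open Scope classical_set_scope.
Local Open Scope ring_scope.

(* [trans] and [reward] are total functions, but only their values on
   admissible pairs (a \in adm s) are constrained or ever matter.
   A state space is nonempty. *)
Record mdp (R : realType) (S A : finType) := MDP {
  adm : S -> {set A};
  trans : S -> A -> S -> R;   (* trans s a s' = P(s' | s, a) *)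
  reward : S -> A -> R;
  state_ex : exists s : S, True;
  adm_ex : forall s, exists a, a \in adm s;
  adm_cover : forall a, exists s, a \in adm s;
  trans_ge0 : forall s a s', a \in adm s -> 0 <= trans s a s';
  trans_sum1 : forall s a, a \in adm s -> \sum_s' trans s a s' = 1
}.

Section MDP.
Variables (R : realType) (S A : finType) (M : mdp R S A).

(* u s a = u(a | s) *)
Definition is_RS (u : S -> A -> R) : Prop :=
  forall s, [/\ forall a, 0 <= u s a,
                forall a, a \notin adm M s -> u s a = 0
              & \sum_(a in adm M s) u s a = 1].

Definition is_DS (f : S -> A) : Prop := forall s, f s \in adm M s.

(* Embedding of deterministic policies into randomized ones (Dirac masses). *)
Definition det (f : S -> A) : S -> A -> R := fun s a => (a == f s)%:R.

Definition chain (u : S -> A -> R) (s s' : S) : R :=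
  \sum_(a in adm M s) u s a * trans M s a s'.

(* Entries of the n-th power of a matrix indexed by S. *)
Fixpoint nstep (Q : S -> S -> R) (n : nat) (s s' : S) : R :=
  if n is m.+1 then \sum_x nstep Q m s x * Q x s' else (s == s')%:R.

Definition irreducible (Q : S -> S -> R) : Prop :=
  forall s s', exists n, 0 < nstep Q n s s'.

(* The gcd of the set of possible return times to s is 1. *)
Definition aperiodic (Q : S -> S -> R) : Prop :=
  forall s (d : nat),
    (forall n, (0 < n)%N -> 0 < nstep Q n s s -> (d %| n)%N) -> d = 1%N.

Definition ergodic (Q : S -> S -> R) : Prop := irreducible Q /\ aperiodic Q.

(* Probability, under u and started at s0, of the trajectory
   (s_0, a_0), ..., (s_t, a_t) given by h. *)
Definition traj_prob (u : S -> A -> R) (s0 : S) (t : nat)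
    (h : {ffun 'I_t.+1 -> S * A}) : R :=
  ((h ord0).1 == s0)%:R * u (h ord0).1 (h ord0).2 *
  \prod_(i < t)
    let: (s, a) := h (widen_ord (leqnSn t) i) in
    let: (s', a') := h (lift ord0 i) in
    trans M s a s' * u s' a'.

(* P^u_{s0}(s_t = s, a_t = a) *)
Definition occ (u : S -> A -> R) (s0 : S) (t : nat) (s : S) (a : A) : R :=
  \sum_(h : {ffun 'I_t.+1 -> S * A} | h ord_max == (s, a)) traj_prob u s0 h.

(* pi^u(s, a): the limit, common to all initial states, of the occupation
   probabilities; an unspecified real if there is no such limit. *)
Definition steady (u : S -> A -> R) (s : S) (a : A) : R :=
  get [set p : R | forall s0 : S, occ u s0 t s a @[t --> \oo] --> p].

(* F^u(l) = P(r(s, a) <= l) for (s, a) distributed as pi^u on the set of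
   admissible pairs. *)
Definition cdf (u : S -> A -> R) (l : R) : R :=
  \sum_(k : S * A | (k.2 \in adm M k.1) && (reward M k.1 k.2 <= l))
    steady u k.1 k.2.

Definition VaR (alpha : R) (u : S -> A -> R) : R :=
  inf [set l : R | alpha <= cdf u l].

End MDP.

(* Main.v *)
(** The cdf of the steady-state reward under [u'] is a nondecreasing step
function that jumps only at rewards and reaches 1. Being below [alpha] at
[lambda], it stays below [alpha] up to the smallest reward exceeding [lambda];
the quantile of [u'] is therefore at least that reward.

That [steady] is a genuine probability distribution rests on the convergence of
the chain. Return times to a state form an additive semigroup of gcd 1, hence
contain all large integers, so some power of the transition matrix has a
positive column. Each application of this power shrinks the oscillation of
the columns by a fixed factor, which yields a limit common to all starting
states. *)

Require Import Defs.
From mathcomp Require Import all_boot all_order all_algebra.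
From mathcomp Require Import boolp classical_sets reals.
From mathcomp Require Import topology normedtype sequences.
From mathcomp Require Import zify ring lra.
Local Open Scope ring_scope.
Import Order.TTheory GRing.Theory Num.Theory.
Import numFieldNormedType.Exports.

(** The least positive difference of two elements of [T] divides every element, hence is 1. So [T]
    contains some [a] and [a + 1], whose combinations cover all large integers. *)
Lemma sub_semigroup_cofinite (T : nat -> Prop) :
  T 0%N -> (forall m n, T m -> T n -> T (m + n)%N) ->
  (forall d, (forall n, (0 < n)%N -> T n -> (d %| n)%N) -> d = 1%N) ->
  exists K, forall n, (K <= n)%N -> T n.
Proof.
move=> T0 TD Tgcd.
have TM k n : T n -> T (k * n)%N.
  by move=> Tn; elim: k => [|k IHk]; rewrite ?mul0n // mulSn; apply: TD.
pose D d := `[< (0 < d)%N /\ exists2 a, T a & T (a + d)%N >].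
have exD : exists d, D d.
  (* Without such differences [T] has no positive element, so 2 meets the gcd condition
     vacuously. *)
  apply: contrapT => noD; suff: 2 = 1%N by [].
  apply: Tgcd => n n_gt0 Tn; case: noD; exists n; apply/asboolP.
  by split=> //; exists 0%N; rewrite ?add0n.
case: (ex_minnP exD) => d /asboolP[d_gt0 [a Ta Tad]] dmin.
have d1 : d = 1%N.
  apply: Tgcd => n _ Tn; rewrite /dvdn; apply/negPn/negP => r_neq0.
  have /dmin : D (n %% d)%N.
    apply/asboolP; split; first by rewrite lt0n.
    (* The remainder is again a difference, between [n + n %/ d * a] and [n %/ d * (a + d)]. *)
    exists (n %/ d * (a + d))%N; first exact: TM.
    have -> : (n %/ d * (a + d) + n %% d = n + n %/ d * a)%N.
      by rewrite {3}(divn_eq n d); move: (n %/ d)%N (n %% d)%N => q r; lia.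
    exact: TD (TM _ _ Ta).
  by rewrite leqNgt ltn_mod d_gt0.
rewrite {}d1 addn1 in Tad.
case: (posnP a) => [a0|a_gt0].
  by exists 0%N => n _; rewrite -(muln1 n); apply: TM; rewrite -a0.
(* From [a * a] on, the quotient q of [n] by [a] exceeds the remainder r, so n = (q - r) a + r (a +
   1) has nonnegative coefficients. *)
exists (a * a)%N => n le_aan.
have lt_ra := ltn_pmod n a_gt0.
have le_aq : (a <= n %/ a)%N by rewrite leq_divRL.
have -> : (n = (n %/ a - n %% a) * a + n %% a * a.+1)%N.
  rewrite mulnS addnCA -mulnDl subnK; last by lia.
  by rewrite addnC -divn_eq.
by apply: TD; apply: TM.
Qed.

(** * Convergence of the powers of a stochastic matrix *)

Section StochasticMatrix.
Local Open Scope classical_set_scope.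
Local Open Scope ring_scope.
Context {R : realType} {S : finType} {Q : S -> S -> R}.
Hypothesis Q_ge0 : forall s s', 0 <= Q s s'.
Hypothesis Q_sum1 : forall s, \sum_s' Q s s' = 1.

Lemma nstep_ge0 n s s' : 0 <= nstep Q n s s'.
Proof.
elim: n s' => [|n IHn] s' /=; first exact: ler0n.
by apply: sumr_ge0 => x _; apply: mulr_ge0.
Qed.

Lemma nstep_sum1 n s : \sum_s' nstep Q n s s' = 1.
Proof.
elim: n => [|n IHn] /=.
  by rewrite (bigD1 s) //= eqxx big1 ?addr0 // => x /negPf; rewrite eq_sym => ->.
rewrite exchange_big /= -IHn; apply: eq_bigr => x _.
by rewrite -mulr_sumr Q_sum1 mulr1.
Qed.

Lemma nstepD m n s s' :
  nstep Q (m + n) s s' = \sum_x nstep Q m s x * nstep Q n x s'.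
Proof.
elim: n s' => [|n IHn] s'.
  rewrite addn0 (bigD1 s') //= eqxx mulr1 big1 ?addr0 // => x /negPf ->.
  by rewrite mulr0.
rewrite addnS /=; under eq_bigr do rewrite IHn mulr_suml.
rewrite exchange_big /=; apply: eq_bigr => x _; rewrite mulr_sumr.
by apply: eq_bigr => y _; rewrite mulrA.
Qed.

Lemma nstepD_gt0 m n s x s' :
  0 < nstep Q m s x -> 0 < nstep Q n x s' -> 0 < nstep Q (m + n) s s'.
Proof.
move=> Qm Qn; rewrite nstepD (bigD1 x) //=.
apply: ltr_pwDl; first exact: mulr_gt0.
by apply: sumr_ge0 => y _; rewrite mulr_ge0 ?nstep_ge0.
Qed.

(** Each state reaches [s1] at some time of its own; the time left until the common [N] is at least
    [K], hence a possible return time to [s1]. *)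
Lemma ergodic_nstep_gt0 (s1 : S) : ergodic Q ->
  exists N, forall s, 0 < nstep Q N s s1.
Proof.
move=> [Qirr Qap].
have [||d|K TK] := @sub_semigroup_cofinite (fun n => 0 < nstep Q n s1 s1).
- by rewrite /= eqxx.
- by move=> m n; apply: nstepD_gt0.
- exact: Qap.
have [n_ Qn] : {n_ : S -> nat & forall s, 0 < nstep Q (n_ s) s s1}.
  by apply: (@choice _ _ (fun s n => 0 < nstep Q n s s1)) => s; apply: Qirr.
exists (\max_s n_ s + K)%N => s.
have le_ns : (n_ s <= \max_s n_ s)%N by apply: leq_bigmax.
have -> : (\max_s n_ s + K = n_ s + (\max_s n_ s - n_ s + K))%N by lia.
by apply: (nstepD_gt0 _ _ _ s1) => //; apply: TK; apply: leq_addl.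
Qed.

(** The rows of [Q^n] are probability vectors, so the new entries of the column are averages of the
    old ones. *)
Lemma nstep_bounds m n s' lo hi :
  (forall s, lo <= nstep Q m s s' <= hi) ->
  forall s, lo <= nstep Q (n + m) s s' <= hi.
Proof.
move=> bnd s; rewrite nstepD -[lo]mul1r -[hi]mul1r -(nstep_sum1 n s) !mulr_suml.
by apply/andP; split; apply: ler_sum => x _; apply: ler_wpM2l;
  rewrite ?nstep_ge0 //; case/andP: (bnd x).
Qed.

(* Doeblin's argument: all rows of [Q^N] put mass at least [delta] on the
   same state [s1], so that one application of [Q^N] pulls every value towards
   the value at [s1]. *)
Lemma nstep_contract N (s1 : S) (delta : R) m s' lo hi :
  (forall s, delta <= nstep Q N s s1) ->
  (forall s, lo <= nstep Q m s s' <= hi) ->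
  exists lo' hi', hi' - lo' = (1 - delta) * (hi - lo) /\
    forall s, lo' <= nstep Q (N + m) s s' <= hi'.
Proof.
move=> le_delta bnd; set v := nstep Q m s1 s'.
exists (delta * v + (1 - delta) * lo), (delta * v + (1 - delta) * hi).
split=> [|s]; first by ring.
have /andP[lov vhi] := bnd s1; rewrite -/v in lov vhi.
(* Rows sum to 1, so a constant can be taken out. With [c = lo] or [c = hi] all remaining terms have
   the same sign, and it suffices to keep the one at [s1]. *)
have shift c : nstep Q (N + m) s s' =
    c + \sum_x nstep Q N s x * (nstep Q m x s' - c).
  under eq_bigr do rewrite mulrBr.
  by rewrite sumrB -mulr_suml nstep_sum1 mul1r nstepD addrC subrK.
apply/andP; split.
- rewrite (shift lo) (bigD1 s1) //= -/v.
  have : delta * (v - lo) <= nstep Q N s s1 * (v - lo).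
    by apply: ler_wpM2r; rewrite ?subr_ge0.
  have : 0 <= \sum_(x | x != s1) nstep Q N s x * (nstep Q m x s' - lo).
    apply: sumr_ge0 => x _; rewrite mulr_ge0 ?nstep_ge0 ?subr_ge0 //.
    by case/andP: (bnd x).
  by move: (\sum_(x | _) _) => X; lra.
- rewrite (shift hi) (bigD1 s1) //= -/v.
  have : delta * (hi - v) <= nstep Q N s s1 * (hi - v).
    by apply: ler_wpM2r; rewrite ?subr_ge0.
  have : \sum_(x | x != s1) nstep Q N s x * (nstep Q m x s' - hi) <= 0.
    apply: sumr_le0 => x _; rewrite mulr_ge0_le0 ?nstep_ge0 ?subr_le0 //.
    by case/andP: (bnd x).
  by move: (\sum_(x | _) _) => X; lra.
Qed.

Lemma ergodic_nstep_cvg (s' : S) : ergodic Q ->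
  exists p : R, forall s, nstep Q n s s' @[n --> \oo] --> p.
Proof.
move=> Qerg; have [N QN] := ergodic_nstep_gt0 s' Qerg.
(* The default 1 gives [delta <= 1] at once, so the factor [1 - delta] lies in [0, 1). *)
pose delta := \big[Order.min/1]_s nstep Q N s s'.
have le_delta s : delta <= nstep Q N s s' by apply: bigmin_le.
have delta_gt0 : 0 < delta by apply/bigmin_gtP.
have delta_le1 : delta <= 1 by apply: bigmin_le_id.
have squeeze k : exists lo hi, hi - lo = (1 - delta) ^+ k /\
    forall s, lo <= nstep Q (k * N) s s' <= hi.
  elim: k => [|k [lo [hi [width bnd]]]].
    exists 0, 1; split=> [|s]; first by rewrite subr0.
    by rewrite mul0n /=; case: eqP; rewrite ?lexx ler01.
  have [lo' [hi' [width' bnd']]] := nstep_contract N s' _ _ _ _ _ le_delta bnd.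
  by exists lo', hi'; rewrite width' width exprS mulSn.
(* The limit is the supremum of the eventual lower bounds of the column: it lies in every enclosing
   interval [lo, hi], and these shrink geometrically. *)
pose L := [set x : R | exists n, forall m s, (n <= m)%N -> x <= nstep Q m s s'].
have tail k lo hi : (forall s, lo <= nstep Q k s s' <= hi) ->
    forall n s, (k <= n)%N -> lo <= nstep Q n s s' <= hi.
  by move=> bnd n s kn; rewrite -(subnK kn); apply: nstep_bounds.
have supL k lo hi : (forall s, lo <= nstep Q k s s' <= hi) -> lo <= sup L <= hi.
  move=> bnd; have Llo : L lo.
    by exists k => m s km; case/andP: (tail _ _ _ bnd m s km).
  have Lhi : ubound L hi.
    move=> x [n Ln]; apply: (le_trans (Ln (maxn n k) s' (leq_maxl _ _))).
    by case/andP: (tail _ _ _ bnd (maxn n k) s' (leq_maxr _ _)).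
  apply/andP; split; first by apply: ub_le_sup => //; exists hi.
  by apply: ge_sup => //; exists lo.
exists (sup L) => s; apply/cvgrPdist_lt => e e_gt0.
have /cvgrPdist_lt/(_ e e_gt0) : (1 - delta) ^+ k @[k --> \oo] --> (0 : R).
  by apply: cvg_expr; rewrite ger0_norm; lra.
case=> k _ /(_ k (leqnn k)) /=.
have [lo [hi [width bnd]]] := squeeze k.
rewrite sub0r normrN -width => ltk.
exists (k * N)%N => // n /= kn.
have /andP[? ?] := tail _ _ _ bnd n s kn; have /andP[? ?] := supL _ _ _ bnd.
apply: le_lt_trans ltk; rewrite (le_trans _ (ler_norm _)) // ler_norml.
by apply/andP; split; lra.
Qed.

End StochasticMatrix.

(** * The steady-state distribution and its cdf *)

Section SteadyState.
Local Open Scope classical_set_scope.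
Local Open Scope ring_scope.
Context {R : realType} {S A : finType} {M : mdp R S A}.

Lemma det_RS f : is_DS M f -> is_RS M (det R f).
Proof.
move=> Mf s; split=> [a|a aM|]; first exact: ler0n.
  by rewrite /det; case: eqP aM => // ->; rewrite Mf.
rewrite (bigD1 (f s)) //= /det eqxx big1 ?addr0 // => a /andP[_ /negPf ->].
by [].
Qed.

Context {u : S -> A -> R}.

Lemma occ0 s0 s a : occ M u s0 0 s a = (s0 == s)%:R * u s a.
Proof.
rewrite /occ (big_pred1 [ffun=> (s, a)]).
  by rewrite /traj_prob big_ord0 mulr1 !ffunE /= eq_sym.
move=> h /=; apply/eqP/eqP => [hsa|->]; last by rewrite ffunE.
by apply/ffunP => i; rewrite ffunE -hsa; congr (h _); apply: val_inj; case: i => [[]].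
Qed.

Lemma occS s0 t s' a' : occ M u s0 t.+1 s' a' =
  \sum_(k : S * A) occ M u s0 t k.1 k.2 * (trans M k.1 k.2 s' * u s' a').
Proof.
(* Appending the last pair ([ext]) and dropping it ([res]) match the trajectories ending in
   [(s', a')] with the trajectories one step shorter. *)
pose ext (g : {ffun 'I_t.+1 -> S * A}) : {ffun 'I_t.+2 -> S * A} :=
  [ffun i => if unlift ord_max i is Some j then g j else (s', a')].
pose res (h : {ffun 'I_t.+2 -> S * A}) : {ffun 'I_t.+1 -> S * A} :=
  [ffun j => h (lift ord_max j)].
have ext_max g : ext g ord_max = (s', a') by rewrite ffunE unlift_none.
have ext_widen g (i : 'I_t.+2) (j : 'I_t.+1) : i = j :> nat -> ext g i = g j.
  move=> ij; rewrite ffunE; have -> : i = lift ord_max j.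
    by apply: val_inj; rewrite [RHS]lift_max.
  by rewrite liftK.
rewrite /occ (reindex_onto ext res) /=; last first.
  move=> h /eqP hmax; apply/ffunP => i; rewrite ffunE.
  by case: unliftP => [j|] ->; rewrite ?ffunE.
under eq_bigl => g.
  have -> : (ext g ord_max == (s', a')) && (res (ext g) == g) = true.
    rewrite ext_max eqxx; apply/eqP/ffunP => j.
    by rewrite !ffunE liftK.
  over.
under [RHS]eq_bigr do rewrite mulr_suml.
rewrite (exchange_big_dep xpredT) //=; apply: eq_bigr => g _.
rewrite (big_pred1 (g ord_max)); last first.
  by move=> k /=; rewrite -surjective_pairing eq_sym.
rewrite /traj_prob big_ord_recr /= mulrA (ext_widen g ord0 ord0) //.
congr (_ * _ * _).
  apply: eq_bigr => i _.
  by rewrite (ext_widen g _ (widen_ord (leqnSn t) i)) // (ext_widen g _ (lift ord0 i)).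
rewrite (ext_widen g _ ord_max) //.
have -> : lift ord0 ord_max = ord_max :> 'I_t.+2 by apply: val_inj.
by rewrite ext_max; case: (g ord_max).
Qed.

Hypothesis uRS : is_RS M u.

(** Given the current state, the action is drawn from [u] whatever the past. [chain] omits
    inadmissible actions, which have probability 0 under [u]. *)
Lemma occE s0 t s a : occ M u s0 t s a = nstep (chain M u) t s0 s * u s a.
Proof.
elim: t s a => [|t IHt] s' a'; first exact: occ0.
rewrite occS; under eq_bigr do rewrite IHt.
rewrite -(pair_bigA _ (fun s a => nstep (chain M u) t s0 s * u s a *
  (trans M s a s' * u s' a'))) /= mulr_suml; apply: eq_bigr => s _.
rewrite /chain mulr_sumr mulr_suml [LHS](bigID (mem (adm M s))) /=.
rewrite [X in _ + X]big1 ?addr0 => [|a aM]; last first.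
  by have [_ -> //] := uRS s; rewrite mulr0 mul0r.
by apply: eq_bigr => a _; rewrite !mulrA.
Qed.

Lemma chain_ge0 s s' : 0 <= chain M u s s'.
Proof.
apply: sumr_ge0 => a aM; apply: mulr_ge0; last exact: trans_ge0.
by case: (uRS s).
Qed.

Lemma chain_sum1 s : \sum_s' chain M u s s' = 1.
Proof.
rewrite exchange_big /=; have [_ _ <-] := uRS s.
by apply: eq_bigr => a aM; rewrite -mulr_sumr trans_sum1 // mulr1.
Qed.

Hypothesis uerg : ergodic (chain M u).

(** [get] is meaningful once one limit serves all [s0]; the common limit [p] of column [s] provides
    it, as [p * u s a]. *)
Lemma occ_cvg_steady s0 s a : occ M u s0 t s a @[t --> \oo] --> steady M u s a.
Proof.
have [p cvp] := ergodic_nstep_cvg chain_ge0 chain_sum1 s uerg.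
suff /getPex : exists q, [set p : R | forall s0, occ M u s0 t s a @[t --> \oo] --> p] q.
  by apply.
exists (p * u s a) => s1 /=.
under eq_fun do rewrite occE.
by apply: cvgMl.
Qed.

Lemma steady_ge0 s a : 0 <= steady M u s a.
Proof.
have [s0 _] := state_ex M.
apply: (cvgr_to_ge (occ_cvg_steady s0 s a)).
apply: nearW => t; rewrite occE mulr_ge0 ?nstep_ge0 //; first exact: chain_ge0.
by case: (uRS s).
Qed.

(** The total mass is 1 at each time, and a finite sum commutes with the limit. *)
Lemma steady_sum1 : \sum_(k : S * A | k.2 \in adm M k.1) steady M u k.1 k.2 = 1.
Proof.
have [s0 _] := state_ex M.
have cvs : \sum_(k : S * A | k.2 \in adm M k.1) occ M u s0 t k.1 k.2 @[t --> \oo]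
    --> \sum_(k : S * A | k.2 \in adm M k.1) steady M u k.1 k.2.
  by apply: cvg_big => [|k _]; [exact: add_continuous|apply: occ_cvg_steady].
have occ_sum1 t : \sum_(k : S * A | k.2 \in adm M k.1) occ M u s0 t k.1 k.2 = 1.
  under eq_bigr do rewrite occE.
  rewrite -(pair_big_dep xpredT (fun s a => a \in adm M s)
    (fun s a => nstep (chain M u) t s0 s * u s a)) /=.
  rewrite -[RHS](nstep_sum1 chain_sum1 t s0); apply: eq_bigr => s _.
  by rewrite -mulr_sumr; have [_ _ ->] := uRS s; rewrite mulr1.
rewrite (eq_fun occ_sum1) in cvs.
by apply: (cvg_unique _ cvs) => //; apply: cvg_cst.
Qed.

Lemma le_cdf l l' : l <= l' -> cdf M u l <= cdf M u l'.
Proof.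
move=> ll'; rewrite /cdf [leRHS](bigID (fun k => reward M k.1 k.2 <= l)) /=.
rewrite -[leLHS]addr0 lerD ?sumr_ge0 // => [|k _]; last exact: steady_ge0.
rewrite le_eqVlt; apply/orP; left; apply/eqP; apply: eq_bigl => k.
rewrite -andbA; congr (_ && _); case: (boolP (_ <= l)) => [kl|]; rewrite ?andbF //.
by rewrite (le_trans kl ll').
Qed.

Lemma cdf_eventually1 : exists l, cdf M u l = 1.
Proof.
(* This sum dominates every single reward. *)
exists (\sum_(k : S * A) `|reward M k.1 k.2|); rewrite -steady_sum1.
apply: eq_bigl => k; rewrite (bigD1 k) //= (le_trans (ler_norm _)) ?andbT //.
by rewrite lerDl sumr_ge0.
Qed.

End SteadyState.

Theorem theorem2 (R : realType) (S A : finType) (M : mdp R S A)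
  (Herg : forall u : S -> A -> R, is_RS M u -> ergodic (chain M u))
  (alpha : R) (Halpha0 : 0 < alpha) (Halpha1 : alpha <= 1)
  (u : S -> A) (Hu : is_DS M u)
  (lambda : R) (Hlambda : lambda = VaR M alpha (det R u))
  (u' : S -> A) (Hu' : is_DS M u') (Hneq : u' <> u)
  (HF : cdf M (det R u') lambda < alpha) :
  VaR M alpha (det R u') > VaR M alpha (det R u).
Proof.
rewrite -Hlambda.
have uRS := det_RS _ Hu'; have uerg := Herg _ uRS.
have [l1 l1P] := cdf_eventually1 uRS uerg.
(* Otherwise both cdf values sum over the same pairs, against [HF]; the case [l < lambda] is
   excluded by monotonicity. *)
have reward_gt l : alpha <= cdf M (det R u') l ->
    exists k : S * A, lambda < reward M k.1 k.2 <= l.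
  move=> al; apply: contrapT => noreward; have := HF; rewrite ltNge => /negP; apply.
  apply: (le_trans al); rewrite /cdf le_eqVlt; apply/orP; left; apply/eqP.
  apply: eq_bigl => k; congr (_ && _); apply/idP/idP => [kl|kl].
    by rewrite leNgt; apply/negP => lk; apply: noreward; exists k; rewrite lk.
  apply: (le_trans kl); rewrite leNgt; apply/negP => ll.
  by move: HF; rewrite ltNge (le_trans al) // le_cdf // ltW.
(* Here [alpha <= 1] makes the set under the infimum nonempty. *)
have El1 : alpha <= cdf M (det R u') l1 by rewrite l1P.
have [k0 /andP[k0P _]] := reward_gt _ El1.
(* The least reward above [lambda] is a single lower bound for that set, so the strict inequality
   survives the infimum. *)
case: (@arg_minP _ _ _ k0 (fun k => lambda < reward M k.1 k.2)
  (fun k => reward M k.1 k.2) k0P) => k kP kmin.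
apply: (lt_le_trans kP); apply: lb_le_inf; first by exists l1.
move=> l /reward_gt[k1 /andP[k1P k1l]].
exact: le_trans (kmin _ k1P) k1l.
Qed.
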